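(* Let $p$ be an odd prime, let $c\in\mathbb{Q}_p$, and let $f:\mathbb{Q}_p^2\to\mathbb{Q}_p^2$, $f(x,y)=(xy+c,x)$. If $|c|=1$, then $\mathcal{K}^-\subset\mathsf{C}_0$, that is, $$\mathcal{K}^-\subset\{(x,y)\in\mathsf{Q}:\max\{|x|,|y|\}=1\}.$$
   Context: $|\cdot|$ is the $p$-adic norm on $\mathbb{Q}_p$ (with $|p|=1/p$). The inverse of $f$ is the map $f^{-1}(x,y)=\left(y,\frac{x-c}{y}\right)$, defined for $y\neq 0$; $f^{-n}$ denotes its $n$-th iterate. $\mathsf{Q}=\{(x,y)\in\mathbb{Q}_p^2: f^{-n}(x,y)\text{ exists for all positive integers } n\}$; writing $(x_{-n},y_{-n})=f^{-n}(x,y)$, with $(x_0,y_0)=(x,y)$, this means $y_{-n}\neq 0$ for all $n\ge 0$. The backward Julia set is $\mathcal{K}^-=\{(x,y)\in\mathsf{Q}:(f^{-n}(x,y))_{n\ge 1}\text{ is bounded}\}$, bounded with respect to $\|(x,y)\|=\max\{|x|,|y|\}$. For $|c|=1$, $\mathsf{C}_0=\{(x,y)\in\mathsf{Q}:\max\{|x|,|y|\}=1\}$. *)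

(* Defs.v *)
From HB Require Import structures.
From mathcomp Require Import all_boot all_order all_algebra.
From mathcomp Require Import generic_quotient ring_quotient.
From mathcomp Require Import boolp classical_sets functions.

Set Implicit Arguments.
Unset Strict Implicit.
Unset Printing Implicit Defensive.

Import Order.TTheory GRing.Theory Num.Theory.
Local Open Scope quotient_scope.
Local Open Scope ring_scope.

(* The field [padic p] of p-adic numbers is the completion of [rat] for the
   p-adic absolute value: Cauchy sequences modulo null sequences.  Since
   [logn p] vanishes when [p] is not prime, the absolute value is then the
   trivial one, so no primality assumption is needed in the construction. *)

Section PadicAbs.
Variable p : nat.
Implicit Types x y z : rat.

Definition padic_val x : int :=
  (logn p `|numq x|%N)%:Z - (logn p `|denq x|%N)%:Z.

Definition padic_abs x : rat :=
  if x == 0 then 0 else p%:R ^ (- padic_val x).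

Lemma padic_val_frac (a b : int) : a != 0 -> b != 0 ->
  padic_val (a%:~R / b%:~R) = (logn p `|a|%N)%:Z - (logn p `|b|%N)%:Z.
Proof.
move=> a0 b0; move e : (a%:~R / b%:~R) => x.
have x0 : x != 0 by rewrite -e mulf_neq0 ?invr_eq0 ?intr_eq0.
have {}e : numq x * b = a * denq x.
  apply/eqP; rewrite -(eqr_int rat) !intrM -eqr_div ?intr_eq0 ?denq_neq0 //.
  by rewrite divq_num_den e.
have {}e := congr1 (fun z : int => logn p `|z|%N) e.
move: e; rewrite !abszM !lognM ?absz_gt0 ?numq_eq0 ?denq_neq0 // => e.
by apply/eqP; rewrite /padic_val subr_eq addrAC eq_sym subr_eq -!PoszD -e.
Qed.

Lemma padic_valM x y : x != 0 -> y != 0 ->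
  padic_val (x * y) = padic_val x + padic_val y.
Proof.
move=> x0 y0.
have -> : x * y = (numq x * numq y)%:~R / (denq x * denq y)%:~R.
  rewrite (intrM _ (numq x)) (intrM _ (denq x)) -mulf_div.
  by rewrite !divq_num_den.
rewrite padic_val_frac ?mulf_neq0 ?numq_eq0 ?denq_neq0 //.
rewrite !abszM !lognM ?absz_gt0 ?numq_eq0 ?denq_neq0 //.
by rewrite /padic_val !PoszD opprD addrACA.
Qed.

Lemma logn_nprime n : ~~ prime p -> logn p n = 0%N.
Proof. by move=> /negbTE pN; rewrite lognE pN. Qed.

Lemma padic_val_nprime x : ~~ prime p -> padic_val x = 0.
Proof. by move=> pN; rewrite /padic_val !logn_nprime. Qed.

Lemma padic_abs0 : padic_abs 0 = 0. Proof. by rewrite /padic_abs eqxx. Qed.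

Lemma padic_abs_gt0 x : x != 0 -> 0 < padic_abs x.
Proof.
move=> x0; rewrite /padic_abs (negbTE x0).
have [pp|/padic_val_nprime->] := boolP (prime p); last by rewrite oppr0 expr0z.
by rewrite exprz_gt0 // ltr0n prime_gt0.
Qed.

Lemma padic_abs_ge0 x : 0 <= padic_abs x.
Proof.
by have [->|/padic_abs_gt0/ltW//] := eqVneq x 0; rewrite padic_abs0.
Qed.

Lemma padic_abs_eq0 x : (padic_abs x == 0) = (x == 0).
Proof.
have [->|/padic_abs_gt0] := eqVneq x 0; first by rewrite padic_abs0 eqxx.
by rewrite lt0r => /andP[/negbTE].
Qed.

Lemma padic_absM x y : padic_abs (x * y) = padic_abs x * padic_abs y.
Proof.
have [->|x0] := eqVneq x 0; first by rewrite mul0r padic_abs0 mul0r.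
have [->|y0] := eqVneq y 0; first by rewrite mulr0 padic_abs0 mulr0.
rewrite /padic_abs mulf_eq0 (negbTE x0) (negbTE y0) /= padic_valM // opprD.
have [pp|pN] := boolP (prime p).
  by rewrite expfzDr // pnatr_eq0 -lt0n prime_gt0.
by rewrite !padic_val_nprime // oppr0 addr0 expr0z mulr1.
Qed.

Lemma padic_abs1 : padic_abs 1 = 1.
Proof. by rewrite /padic_abs /padic_val /= logn1 subrr oppr0 expr0z. Qed.

Lemma padic_absN x : padic_abs (- x) = padic_abs x.
Proof. by rewrite /padic_abs /padic_val oppr_eq0 numqN denqN abszN. Qed.

Lemma padic_absV x : padic_abs x^-1 = (padic_abs x)^-1.
Proof.
have [->|x0] := eqVneq x 0; first by rewrite !(invr0, padic_abs0).
have := padic_absM x x^-1; rewrite divff // padic_abs1 => /esym e.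
by rewrite -[RHS]mulr1 -e mulKf // padic_abs_eq0.
Qed.

Lemma padic_abs_int (a : int) : a != 0 ->
  padic_abs a%:~R = p%:R ^- logn p `|a|%N.
Proof.
move=> a0; rewrite /padic_abs intr_eq0 (negbTE a0) -[a%:~R]divr1 -[1]/(1%:~R).
by rewrite padic_val_frac // logn1 subr0 exprnN.
Qed.

Lemma padic_abs_prime : prime p -> padic_abs p%:R = p%:R^-1.
Proof.
move=> pp; have p0 : p != 0%N by rewrite -lt0n prime_gt0.
by rewrite -[p%:R]/(p%:~R) padic_abs_int // absz_nat logn_prime // eqxx expr1.
Qed.

Lemma padic_absD x y : padic_abs (x + y) <= Num.max (padic_abs x) (padic_abs y).
Proof.
have int_case (a b : int) : padic_abs (a + b)%:~R <=
    Num.max (padic_abs a%:~R) (padic_abs b%:~R).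
  have [->|a0] := eqVneq a 0; first by rewrite add0r le_max lexx orbT.
  have [->|b0] := eqVneq b 0; first by rewrite addr0 le_max lexx.
  have [->|ab0] := eqVneq (a + b) 0.
    by rewrite padic_abs0 le_max padic_abs_ge0.
  rewrite !padic_abs_int //.
  have [pp|pN] := boolP (prime p); last first.
    by rewrite !logn_nprime // expr0 maxxx.
  have mono (m n : nat) : (p%:R ^- m <= p%:R ^- n :> rat) = (n <= m)%N.
    rewrite lef_pV2 ?posrE ?exprn_gt0 ?ltr0n ?prime_gt0 //.
    by rewrite ler_eXn2l // ltr1n prime_gt1.
  rewrite le_max !mono; apply/orP.
  set k := minn (logn p `|a|) (logn p `|b|).
  suff kab : (k <= logn p `|(a + b)%R|)%N.
    by move: kab; rewrite /k geq_min => /orP[]; [left|right].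
  rewrite -pfactor_dvdn ?absz_gt0 // -[(_ ^ k)%N]absz_nat -dvdzE.
  apply: rpredD; rewrite dvdzE absz_nat pfactor_dvdn ?absz_gt0 //.
    by rewrite geq_minl.
  by rewrite geq_minr.
pose d : rat := (denq x * denq y)%:~R.
have d0 : d != 0 by rewrite intr_eq0 mulf_neq0 ?denq_neq0.
have ex : x = (numq x * denq y)%:~R / d.
  rewrite /d (intrM _ (numq x)) (intrM _ (denq x)) -mulf_div divq_num_den.
  by rewrite divff ?mulr1 // intr_eq0 denq_neq0.
have ey : y = (denq x * numq y)%:~R / d.
  rewrite /d (intrM _ (denq x) (numq y)) (intrM _ (denq x)) -mulf_div.
  by rewrite divq_num_den divff ?mul1r // intr_eq0 denq_neq0.
rewrite ex ey -mulrDl !(padic_absM _ d^-1) -maxr_pMl ?padic_abs_ge0 //.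
by rewrite ler_wpM2r ?padic_abs_ge0 // -intrD int_case.
Qed.

Lemma padic_abs_lt_eq x y : padic_abs (x - y) < padic_abs y ->
  padic_abs x = padic_abs y.
Proof.
move=> xy; apply/le_anti/andP; split.
  rewrite -{1}(subrK y x); apply: (le_trans (padic_absD _ _)).
  by rewrite ge_max lexx ltW.
rewrite leNgt; apply/negP => yx.
have := padic_absD x (y - x); rewrite [x + _]addrC subrK -(padic_absN (y - x)) opprB.
by rewrite leNgt gt_max xy yx.
Qed.

End PadicAbs.

Section CauchySequences.
Variable p : nat.
Implicit Types a b : nat -> rat.

Definition padic_cauchy a := forall e : rat, 0 < e ->
  exists N : nat, forall m n : nat, (N <= m)%N -> (N <= n)%N ->
    padic_abs p (a m - a n) < e.

Definition padic_null a := forall e : rat, 0 < e ->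
  exists N : nat, forall n : nat, (N <= n)%N -> padic_abs p (a n) < e.

Lemma padic_cauchy_bounded a : padic_cauchy a ->
  exists2 M : rat, 0 < M & exists N : nat, forall n : nat, (N <= n)%N ->
    padic_abs p (a n) <= M.
Proof.
move=> /(_ 1 ltr01) [N aN].
exists (Num.max 1 (padic_abs p (a N))); first by rewrite lt_max ltr01.
exists N => n Nn; rewrite -(subrK (a N) (a n)).
apply: (le_trans (padic_absD _ _ _)).
by rewrite ge_max !le_max lexx orbT (ltW (aN _ _ Nn (leqnn N))).
Qed.

Lemma padic_cauchy_nonnull a : padic_cauchy a -> ~ padic_null a ->
  exists2 r : rat, 0 < r & exists N : nat, forall n : nat, (N <= n)%N ->
    padic_abs p (a n) = r.
Proof.
move=> ca /existsNP[e /not_implyP[e0 /forallNP ae]].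
have [N aN] := ca e e0.
have /existsNP[n0 /not_implyP[Nn0 /negP]] := ae N; rewrite -leNgt => en0.
exists (padic_abs p (a n0)); first exact: lt_le_trans en0.
by exists N => n Nn; apply: padic_abs_lt_eq; apply: lt_le_trans (aN _ _ Nn Nn0) en0.
Qed.

Definition padic_cauchy_pred : {pred nat -> rat} :=
  fun a => `[< padic_cauchy a >].

Lemma padic_cauchy_subring : subring_closed padic_cauchy_pred.
Proof.
split; rewrite /in_mem /=.
- by apply/asboolP => e e0; exists 0%N => m n _ _; rewrite subrr padic_abs0.
- move=> a b /asboolP ca /asboolP cb; apply/asboolP => e e0.
  have [Na aN] := ca e e0; have [Nb bN] := cb e e0.
  exists (maxn Na Nb) => m n; rewrite !geq_max => /andP[am bm] /andP[an bn].
  have -> : (a - b) m - (a - b) n = (a m - a n) - (b m - b n).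
    rewrite -[(a - b) m]/(a m - b m) -[(a - b) n]/(a n - b n).
    by rewrite !opprB [b n - _]addrC addrACA [- b m + _]addrC.
  apply: (le_lt_trans (padic_absD _ _ _)).
  by rewrite gt_max padic_absN aN // bN.
- move=> a b /asboolP ca /asboolP cb; apply/asboolP => e e0.
  have [A A0 [Na aA]] := padic_cauchy_bounded ca.
  have [B B0 [Nb bB]] := padic_cauchy_bounded cb.
  have [Na' aN] := ca _ (divr_gt0 e0 B0); have [Nb' bN] := cb _ (divr_gt0 e0 A0).
  exists (maxn (maxn Na Na') (maxn Nb Nb')) => m n; rewrite !geq_max.
  move=> /andP[/andP[am am'] /andP[bm bm']] /andP[/andP[an an'] /andP[bn bn']].
  have -> : (a * b) m - (a * b) n = a m * (b m - b n) + (a m - a n) * b n.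
    rewrite -[(a * b) m]/(a m * b m) -[(a * b) n]/(a n * b n).
    by rewrite mulrBr mulrBl addrA subrK.
  apply: (le_lt_trans (padic_absD _ _ _)); rewrite gt_max !padic_absM.
  apply/andP; split.
    rewrite -(divfK (lt0r_neq0 A0) e) mulrC.
    apply: (@le_lt_trans _ _ (padic_abs p (b m - b n) * A)).
      by rewrite ler_wpM2l ?padic_abs_ge0 // aA.
    by rewrite ltr_pM2r // bN.
  rewrite -(divfK (lt0r_neq0 B0) e).
  apply: (@le_lt_trans _ _ (padic_abs p (a m - a n) * B)).
    by rewrite ler_wpM2l ?padic_abs_ge0 // bB.
  by rewrite ltr_pM2r // aN.
Qed.

HB.instance Definition _ :=
  GRing.isSubringClosed.Build _ padic_cauchy_pred padic_cauchy_subring.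

Definition padic_cauchy_seq : Type := {a : nat -> rat | a \in padic_cauchy_pred}.

HB.instance Definition _ := SubChoice.on padic_cauchy_seq.
HB.instance Definition _ := [SubChoice_isSubComNzRing of padic_cauchy_seq by <:].

Lemma padic_cauchyP (a : padic_cauchy_seq) : padic_cauchy (val a).
Proof. by apply/asboolP; exact: (valP a). Qed.

Definition padic_null_pred : pred padic_cauchy_seq :=
  fun u => `[< padic_null (val u) >].

Lemma padic_null_idealr_closed : idealr_closed padic_null_pred.
Proof.
split; rewrite /in_mem /=.
- by apply/asboolP => e e0; exists 0%N => n _; rewrite raddf0 padic_abs0.
- apply/negP => /asboolP/(_ 1 ltr01)[N /(_ N (leqnn N))].
  by rewrite rmorph1 padic_abs1 ltxx.
- move=> a u v /asboolP nu /asboolP nv; apply/asboolP => e e0.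
  have [A A0 [Na aA]] := padic_cauchy_bounded (padic_cauchyP a).
  have [Nu uN] := nu _ (divr_gt0 e0 A0); have [Nv vN] := nv _ e0.
  exists (maxn Na (maxn Nu Nv)) => n; rewrite !geq_max => /and3P[an un vn].
  have -> : val (a * u + v) n = val a n * val u n + val v n.
    by rewrite rmorphD rmorphM.
  apply: (le_lt_trans (padic_absD _ _ _)); rewrite gt_max padic_absM vN // andbT.
  rewrite -(divfK (lt0r_neq0 A0) e) mulrC.
  apply: (@le_lt_trans _ _ (padic_abs p (val u n) * A)).
    by rewrite ler_wpM2l ?padic_abs_ge0 // aA.
  by rewrite ltr_pM2r // uN.
Qed.

HB.instance Definition _ := isIdealr.Build _ padic_null_pred padic_null_idealr_closed.

Definition padic_null_ideal : idealr padic_cauchy_seq := padic_null_pred.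

Definition padic : Type := {ideal_quot padic_null_ideal}.

HB.instance Definition _ := GRing.ComNzRing.on padic.

Definition padic_pi (u : padic_cauchy_seq) : padic := \pi u.

Lemma padic_pi_surj (x : padic) : exists u, x = padic_pi u.
Proof. by exists (repr x); rewrite /padic_pi reprK. Qed.

Lemma padic_pi_eq u v : padic_pi u = padic_pi v <-> padic_null (val u - val v).
Proof.
have e : (u - v \in padic_null_ideal) = (padic_pi u == padic_pi v).
  by rewrite (@Quotient.idealrBE _ padic_null_ideal u v) eqquotE.
split=> [/eqP|] H.
  by move: H; rewrite -e => /asboolP; rewrite rmorphB.
by apply/eqP; rewrite -e; apply/asboolP; rewrite rmorphB.
Qed.

Lemma padic_pi_zmod_morphism : zmod_morphism padic_pi.
Proof. by move=> u v; rewrite /padic_pi !piE. Qed.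

HB.instance Definition _ :=
  GRing.isZmodMorphism.Build padic_cauchy_seq padic padic_pi
    padic_pi_zmod_morphism.

Lemma padic_pi_monoid_morphism : monoid_morphism padic_pi.
Proof. by split=> [|u v]; rewrite /padic_pi !piE. Qed.

HB.instance Definition _ :=
  GRing.isMonoidMorphism.Build padic_cauchy_seq padic padic_pi
    padic_pi_monoid_morphism.

End CauchySequences.

Section PadicField.
Variable p : nat.
Local Notation Qp := (padic p).
Implicit Types (x y : Qp) (u v : padic_cauchy_seq p).

Lemma padic_pi_neq0 u : padic_pi u != 0 ->
  exists2 r : rat, 0 < r & exists N : nat, forall n : nat, (N <= n)%N ->
    padic_abs p (val u n) = r.
Proof.
move=> u0; apply: padic_cauchy_nonnull; first exact: padic_cauchyP.
move=> nu; move/eqP: u0; apply; rewrite -(rmorph0 (@padic_pi p)); apply/padic_pi_eq.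
by rewrite rmorph0 subr0.
Qed.

Lemma padic_mulV_ex x : x != 0 -> exists y, y * x = 1.
Proof.
have [u ->] := padic_pi_surj x; move=> /padic_pi_neq0[r r0 [N uN]].
have u0 n : (N <= n)%N -> val u n != 0.
  by move=> Nn; rewrite -(padic_abs_eq0 p) uN // lt0r_neq0.
have cv : padic_cauchy p (fun n => (val u n)^-1).
  move=> e e0; have er0 : 0 < e * (r * r) by rewrite !mulr_gt0.
  have [M uM] := padic_cauchyP u er0.
  exists (maxn N M) => m n; rewrite !geq_max => /andP[Nm Mm] /andP[Nn Mn].
  have -> : (val u m)^-1 - (val u n)^-1 =
      (val u n - val u m) * ((val u m)^-1 * (val u n)^-1).
    by rewrite mulrBl mulrCA divff ?u0 // mulr1 mulVKf ?u0.
  rewrite !padic_absM !padic_absV !uN // -invfM ltr_pdivrMr ?mulr_gt0 //.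
  exact: uM.
have {}cv : (fun n => (val u n)^-1) \in padic_cauchy_pred p by exact/asboolP.
exists (padic_pi (exist (fun a => a \in padic_cauchy_pred p) _ cv)).
rewrite -rmorphM -(rmorph1 (@padic_pi p)); apply/padic_pi_eq => e e0; exists N => n Nn.
rewrite rmorphM rmorph1 /=.
rewrite -[X in padic_abs p X]/((val u n)^-1 * val u n - 1).
by rewrite mulVf ?u0 // subrr padic_abs0.
Qed.

Definition padic_inv x : Qp := xget 0 [set y | y * x = 1].

Lemma padic_mulVf x : x != 0 -> padic_inv x * x = 1.
Proof. by move=> /padic_mulV_ex ex; exact: (@xgetPex _ 0 [set y | y * x = 1]). Qed.

Lemma padic_inv0 : padic_inv 0 = 0.
Proof. by apply: xgetPN => y /=; rewrite mulr0; apply/eqP; rewrite eq_sym oner_eq0. Qed.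

HB.instance Definition _ := GRing.ComNzRing_isField.Build Qp padic_mulVf padic_inv0.

(* |x| is the limit of |a n|_p for any Cauchy sequence [a] representing [x];
   by [padic_normP] it exists and does not depend on the representative. *)
Definition padic_norm x : rat :=
  xget 0 [set r | forall e : rat, 0 < e -> exists N : nat, forall n : nat,
    (N <= n)%N -> `|padic_abs p (val (repr x) n) - r| < e].

Lemma padic_normP u (r : rat) :
  padic_norm (padic_pi u) = r <->
  forall e : rat, 0 < e -> exists N : nat, forall n : nat,
    (N <= n)%N -> `|padic_abs p (val u n) - r| < e.
Proof.
pose lim v r := forall e : rat, 0 < e -> exists N : nat, forall n : nat,
  (N <= n)%N -> `|padic_abs p (val v n) - r| < e.
have lim_uniq v r1 r2 : lim v r1 -> lim v r2 -> r1 = r2.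
  move=> l1 l2; apply/eqP; rewrite -subr_eq0 -normr_le0 leNgt; apply/negP => e0.
  have e20 : 0 < `|r1 - r2| / 2 by rewrite divr_gt0.
  have [N1 h1] := l1 _ e20; have [N2 h2] := l2 _ e20.
  have := h1 _ (leq_maxl N1 N2); have := h2 _ (leq_maxr N1 N2).
  move=> k2 k1; have := ltrD k1 k2; rewrite -splitr distrC => k.
  have := le_lt_trans (ler_normD _ _) k.
  by rewrite addrA subrK -normrN opprB ltxx.
have lim_ex v : exists r, lim v r.
  have [v0|] := eqVneq (padic_pi v) 0.
    exists 0 => e e0; move: v0; rewrite -(rmorph0 (@padic_pi p)) => /padic_pi_eq/(_ e e0).
    rewrite rmorph0 subr0 => -[N vN]; exists N => n /vN.
    by rewrite subr0 ger0_norm // padic_abs_ge0.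
  move=> /padic_pi_neq0[s s0 [N vN]]; exists s => e e0; exists N => n Nn.
  by rewrite vN // subrr normr0.
have lim_congr v w s : padic_pi v = padic_pi w -> lim v s -> lim w s.
  move=> vw.
  have [v0|v0] := eqVneq (padic_pi v) 0.
    have vn : padic_null p (val v).
      by move: v0; rewrite -(rmorph0 (@padic_pi p)) => /padic_pi_eq; rewrite rmorph0 subr0.
    have wn : padic_null p (val w).
      by move: v0; rewrite vw -(rmorph0 (@padic_pi p)) => /padic_pi_eq; rewrite rmorph0 subr0.
    have l0 z : padic_null p (val z) -> lim z 0.
      move=> zn e /zn[N zN]; exists N => n /zN.
      by rewrite subr0 ger0_norm // padic_abs_ge0.
    by move=> /lim_uniq/(_ (l0 _ vn)) ->; exact: l0.
  move: (v0) => /padic_pi_neq0[t t0 [N vN]] ls e e0.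
  have [N1 h1] := ls e e0; have [N2 h2] := (padic_pi_eq w v).1 (esym vw) t t0.
  exists (maxn N (maxn N1 N2)) => n; rewrite !geq_max => /and3P[n0 n1 n2].
  rewrite (@padic_abs_lt_eq _ _ (val v n)) ?h1 // vN //.
  exact: h2.
have pr : padic_pi (repr (padic_pi u)) = padic_pi u.
  by rewrite /padic_pi reprK.
have normE : lim (repr (padic_pi u)) (padic_norm (padic_pi u)).
  by have /(xgetPex 0) := lim_ex (repr (padic_pi u)).
split=> [<-|lr]; first exact: lim_congr pr normE.
exact: lim_uniq (lim_congr _ _ _ pr normE) lr.
Qed.

Lemma padic_norm_pi u (r : rat) :
  (exists N : nat, forall n : nat, (N <= n)%N -> padic_abs p (val u n) = r) ->
  padic_norm (padic_pi u) = r.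
Proof.
move=> [N uN]; apply/padic_normP => e e0; exists N => n /uN ->.
by rewrite subrr normr0.
Qed.

Lemma padic_norm0 : padic_norm 0 = 0.
Proof.
rewrite -(rmorph0 (@padic_pi p)); apply: padic_norm_pi; exists 0%N => n _.
by rewrite rmorph0 padic_abs0.
Qed.

Lemma padic_norm_val x : exists q : rat, padic_norm x = padic_abs p q.
Proof.
have [->|] := eqVneq x 0; first by exists 0; rewrite padic_norm0 padic_abs0.
have [u ->] := padic_pi_surj x; move=> /padic_pi_neq0[r r0 [N uN]].
exists (val u N); rewrite uN //; apply: padic_norm_pi; by exists N.
Qed.

Lemma padic_norm_ge0 x : 0 <= padic_norm x.
Proof. by have [q ->] := padic_norm_val x; exact: padic_abs_ge0. Qed.

Lemma padic_norm_eq0 x : (padic_norm x == 0) = (x == 0).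
Proof.
have [->|] := eqVneq x 0; first by rewrite padic_norm0 eqxx.
have [u ->] := padic_pi_surj x; move=> /padic_pi_neq0[r r0 uN].
by rewrite (padic_norm_pi uN) gt_eqF.
Qed.

Lemma padic_normM x y : padic_norm (x * y) = padic_norm x * padic_norm y.
Proof.
have [->|] := eqVneq x 0; first by rewrite mul0r padic_norm0 mul0r.
have [->|] := eqVneq y 0; first by rewrite mulr0 padic_norm0 mulr0.
have [u ->] := padic_pi_surj x; have [v ->] := padic_pi_surj y.
move=> /padic_pi_neq0[r r0 [N vN]] /padic_pi_neq0[s s0 [M uM]].
rewrite -rmorphM (padic_norm_pi (ex_intro _ N vN)).
rewrite (padic_norm_pi (ex_intro _ M uM)); apply: padic_norm_pi.
exists (maxn N M) => n; rewrite geq_max => /andP[/vN <- /uM <-].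
by rewrite rmorphM padic_absM.
Qed.

Lemma padic_normD x y :
  padic_norm (x + y) <= Num.max (padic_norm x) (padic_norm y).
Proof.
have [->|x0] := eqVneq x 0; first by rewrite add0r le_max lexx orbT.
have [->|y0] := eqVneq y 0; first by rewrite addr0 le_max lexx.
have [->|] := eqVneq (x + y) 0; first by rewrite padic_norm0 le_max padic_norm_ge0.
move: x0 y0; have [u ->] := padic_pi_surj x; have [v ->] := padic_pi_surj y.
rewrite -rmorphD.
move=> /padic_pi_neq0[r r0 [N uN]] /padic_pi_neq0[s s0 [M vM]].
move=> /padic_pi_neq0[t t0 [L wL]].
rewrite (padic_norm_pi (ex_intro _ N uN)) (padic_norm_pi (ex_intro _ M vM)).
rewrite (padic_norm_pi (ex_intro _ L wL)).
pose n := maxn N (maxn M L).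
rewrite -(uN n) ?leq_maxl // -(vM n) ?leq_max ?leqnn ?orbT //.
rewrite -(wL n) ?leq_max ?leqnn ?orbT // rmorphD.
exact: padic_absD.
Qed.

Lemma padic_norm_ratr (q : rat) : padic_norm (ratr q) = padic_abs p q.
Proof.
have norm_int (z : int) : padic_norm z%:~R = padic_abs p z%:~R.
  rewrite -(rmorph_int (@padic_pi p)).
  apply: padic_norm_pi; exists 0%N => n _; rewrite rmorph_int.
  suff -> : (z%:~R : nat -> rat) n = z%:~R by [].
  have natE k : (k%:R : nat -> rat) n = k%:R.
    by elim: k => // k IHk; rewrite -!natr1 -IHk.
  by case: z => k; [exact: natE | exact: (congr1 -%R (natE k.+1))].
rewrite /ratr; set d : Qp := (denq q)%:~R.
have d0 : d != 0.
  by rewrite -padic_norm_eq0 norm_int padic_abs_eq0 intr_eq0 denq_neq0.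
have nd0 : padic_norm d != 0 by rewrite padic_norm_eq0.
apply: (mulIf nd0); rewrite -padic_normM divfK // !norm_int -padic_absM.
by rewrite -[X in X * _]divq_num_den divfK // intr_eq0 denq_neq0.
Qed.

End PadicField.

Section Dynamics.
Variables (p : nat) (c : padic p).
Implicit Types z w : padic p * padic p.

Definition padic_norm2 z : rat := Num.max (padic_norm z.1) (padic_norm z.2).

Definition fmap z : padic p * padic p := (z.1 * z.2 + c, z.1).

Definition fmap_inv z : option (padic p * padic p) :=
  if z.2 == 0 then None else Some (z.2, (z.1 - c) / z.2).

Lemma fmap_invP z w : fmap_inv z = Some w <-> z.2 != 0 /\ fmap w = z.
Proof.
case: z w => [x y] [x' y']; rewrite /fmap_inv /fmap /=.
have [->|y0] := eqVneq y 0; first by split=> // -[].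
split=> [[<- <-]|[_ [<- exy]]].
  by rewrite [y * _]mulrC divfK // subrK.
by rewrite exy addrK mulrAC divff // mul1r.
Qed.

(* [None] as soon as one of the [n] successive inverse images does not exist. *)
Definition fmap_inv_iter (n : nat) z : option (padic p * padic p) :=
  iter n (obind fmap_inv) (Some z).

Definition backward_domain : set (padic p * padic p) :=
  [set z | forall n : nat, (0 < n)%N -> fmap_inv_iter n z <> None].

Definition backward_julia : set (padic p * padic p) :=
  [set z | backward_domain z /\
    exists M : rat, forall (n : nat) w, (0 < n)%N ->
      fmap_inv_iter n z = Some w -> padic_norm2 w <= M].

Definition C0 : set (padic p * padic p) :=
  [set z | backward_domain z /\ padic_norm2 z = 1].

End Dynamics.

(* Main.v *)
(* Put a_0 = x, a_1 = y and a_(n+2) = (a_n - c) / a_(n+1), so that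
   f^-n (x, y) = (a_n, a_(n+1)) and a_(n+1) a_(n+2) = a_n - c.  With
   r_n = |a_n| and |c| = 1, the product r_(n+1) r_(n+2) is r_n if r_n > 1,
   is 1 if r_n < 1, and is at most 1 if r_n = 1.
   If r_n < 1 < r_(n+1), then r_(n+2) = 1 / r_(n+1) < 1 and
   r_(n+3) = r_(n+1)^2, so the orbit is unbounded.  If r_n > 1 >= r_(n+1), this
   situation is reached one or three steps later.  Finally r_m > 1 for all
   m >= n is impossible: values above 1 are at least 2, and
   r_m = r_(m+1) r_(m+2) would at least halve at each step.
   Hence r_n <= 1 for all n, and r_0, r_1 < 1 is excluded since r_1 r_2 = 1
   would force r_2 > 1. *)
Require Import Defs.
From mathcomp Require Import all_boot all_order all_algebra.
From mathcomp Require Import boolp classical_sets functions.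
Local Open Scope classical_set_scope.
Local Open Scope ring_scope.

Import Order.TTheory GRing.Theory Num.Theory.

(** Nonzero values are integer powers of [p] for prime [p], and 1 otherwise; a power above 1 has
    positive exponent, so it is at least [p]. *)
Lemma padic_abs_gt1_ge2 (p : nat) (q : rat) :
  1 < padic_abs p q -> 2 <= padic_abs p q.
Proof.
rewrite /padic_abs; case: eqP => [_|_]; first by rewrite ltr10.
have [pp|/padic_val_nprime->] := boolP (prime p); last by rewrite oppr0 expr0z ltxx.
case: (- padic_val p q) => [[|n]|n]; first by rewrite expr0z ltxx.
  move=> _; rewrite -exprnP -natrX ler_nat.
  apply: leq_trans (prime_gt1 pp) _.
  by rewrite expnS leq_pmulr // expn_gt0 prime_gt0.
rewrite NegzE -exprnN ltNge invf_le1 ?exprn_gt0 ?ltr0n ?prime_gt0 //.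
by rewrite exprn_ege1 // ler1n prime_gt0.
Qed.

Lemma padic_norm_gt1_ge2 (p : nat) (x : padic p) :
  1 < padic_norm x -> 2 <= padic_norm x.
Proof. by have [q ->] := padic_norm_val x; exact: padic_abs_gt1_ge2. Qed.

Lemma padic_norm1 (p : nat) : padic_norm (1 : padic p) = 1.
Proof.
have n1 : padic_norm (1 : padic p) != 0 by rewrite padic_norm_eq0 oner_eq0.
by apply: (mulfI n1); rewrite -padic_normM !mulr1.
Qed.

Lemma padic_normN (p : nat) (x : padic p) : padic_norm (- x) = padic_norm x.
Proof.
have /eqP n1 : padic_norm (-1 : padic p) == 1.
  (* The norm of -1 is nonnegative with square 1. *)
  rewrite -(@pexpr_eq1 _ _ 2) ?padic_norm_ge0 //.
  by rewrite expr2 -padic_normM mulrNN mulr1 padic_norm1.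
by rewrite -mulN1r padic_normM n1 mul1r.
Qed.

Lemma padic_normB (p : nat) (x y : padic p) :
  padic_norm (x - y) <= Num.max (padic_norm x) (padic_norm y).
Proof. by rewrite -(padic_normN _ y); exact: padic_normD. Qed.

Lemma padic_normBl (p : nat) (x y : padic p) :
  padic_norm y < padic_norm x -> padic_norm (x - y) = padic_norm x.
Proof.
move=> yx; apply/le_anti/andP; split.
  by apply: le_trans (padic_normB _ x y) _; rewrite ge_max lexx ltW.
have := padic_normD (x - y) y; rewrite subrK le_max.
by rewrite [padic_norm x <= padic_norm y]leNgt yx orbF.
Qed.

Lemma padic_normBr (p : nat) (x y : padic p) :
  padic_norm x < padic_norm y -> padic_norm (x - y) = padic_norm y.
Proof. by move=> xy; rewrite -padic_normN opprB padic_normBl. Qed.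

Lemma gt1_of_mul_gt1 (a b : rat) : 0 <= b -> a <= 1 -> 1 < a * b -> 1 < b.
Proof. by move=> b0 a1 ab; apply: lt_le_trans ab _; rewrite ler_piMl. Qed.

Lemma lt1_of_mul_le1 (a b : rat) : 1 < a -> a * b <= 1 -> b < 1.
Proof.
move=> a1 ab; rewrite ltNge; apply/negP => b1.
have a_le_ab : a <= a * b by rewrite ler_peMr // ltW // (lt_trans ltr01).
by have := lt_le_trans a1 (le_trans a_le_ab ab); rewrite ltxx.
Qed.

Section NormSequence.
Variables (r : nat -> rat) (M : rat).
Hypothesis r_ge0 : forall n, 0 <= r n.
Hypothesis r_le : forall n, r n.+1 <= M.
Hypothesis r_gap : forall n, 1 < r n -> 2 <= r n.
Hypothesis r_gt1 : forall n, 1 < r n -> r n.+1 * r n.+2 = r n.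
Hypothesis r_lt1 : forall n, r n < 1 -> r n.+1 * r n.+2 = 1.
Hypothesis r_eq1 : forall n, r n = 1 -> r n.+1 * r n.+2 <= 1.

(** The pattern recurs two indices later with its large term squared, hence at least doubled by
    [r_gap]; this eventually exceeds [M]. *)
Lemma not_lt1_gt1 (n : nat) : r n < 1 -> 1 < r n.+1 -> False.
Proof.
have step m : r m < 1 -> 1 < r m.+1 ->
    [/\ r m.+2 < 1, 1 < r m.+3 & 2 * r m.+1 <= r m.+3].
  move=> m0 m1; have m2 : r m.+2 < 1.
    by apply: lt1_of_mul_le1 m1 _; rewrite r_lt1.
  have e : r m.+3 = r m.+1 * r m.+1.
    by rewrite -[LHS]mul1r -(r_lt1 m m0) -mulrA (r_gt1 m.+1).
  split=> //; first by rewrite e mulr_egt1.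
  by rewrite e ler_wpM2r // r_gap.
have grow k : forall m, r m < 1 -> 1 < r m.+1 ->
    exists j, 2 ^+ k * r m.+1 <= r j.+1.
  elim: k => [|k IHk] m m0 m1; first by exists m; rewrite mul1r.
  have [m2 m3 h] := step m m0 m1; have [j hj] := IHk _ m2 m3; exists j.
  by apply: le_trans hj; rewrite exprSr -mulrA ler_wpM2l ?exprn_ge0.
(* [Num.bound M] doublings suffice, since 2 to that power exceeds [M]. *)
move=> n0 n1; have := upper_nthrootP (leqnn (Num.bound M)).
have [j hj] := grow (Num.bound M) n n0 n1; apply/negP; rewrite -leNgt.
apply: le_trans (r_le j); apply: le_trans hj.
by rewrite ler_peMr ?exprn_ge0 // ltW.
Qed.

Lemma gt1_next_gt1 (n : nat) : 1 < r n -> 1 < r n.+1.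
Proof.
move=> n0; have n12 := r_gt1 n n0; rewrite ltNge; apply/negP => n1.
have n2 : 1 < r n.+2 by apply: gt1_of_mul_gt1 n1 _ => //; rewrite n12.
move: n1; rewrite le_eqVlt => /orP[/eqP n1|n1]; last exact: not_lt1_gt1 n1 n2.
(* When [r n.+1] is 1, the forbidden pattern appears at [n.+3], [n.+4]. *)
have n3 : r n.+3 < 1 by apply: lt1_of_mul_le1 n2 _; exact: r_eq1.
apply: (not_lt1_gt1 n.+3) => //.
by apply: gt1_of_mul_gt1 (ltW n3) _ => //; rewrite r_gt1.
Qed.

Lemma norm_seq_le1 (n : nat) : r n <= 1.
Proof.
rewrite leNgt; apply/negP => n0.
have gt1 k : 1 < r (k + n)%N by elim: k => //= k; exact: gt1_next_gt1.
(* Each term is the next one times a factor at least 2, so the fixed [r n] would dominate every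
   power of 2. *)
have decay k : 2 ^+ k <= 2 ^+ k * r (k + n)%N <= r n.
  rewrite ler_peMr ?exprn_ge0 ?(ltW (gt1 k)) //=.
  elim: k => [|k IHk]; first by rewrite mul1r.
  apply: le_trans IHk; rewrite -(r_gt1 (k + n)) // exprSr -mulrA.
  rewrite ler_wpM2l ?exprn_ge0 // mulrC ler_wpM2l //.
  exact/r_gap/(gt1 k.+2).
have := upper_nthrootP (leqnn (Num.bound (r n))); rewrite ltNge => /negP; apply.
by have /andP[] := decay (Num.bound (r n)); exact: le_trans.
Qed.

Lemma norm_seq_max_eq1 : Num.max (r 0) (r 1) = 1.
Proof.
apply/le_anti; rewrite ge_max !norm_seq_le1 /= leNgt gt_max.
apply/negP => /andP[r0 r1]; have : r 1 * r 2 < 1.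
  by apply: le_lt_trans r1; rewrite ler_piMr ?norm_seq_le1.
by rewrite r_lt1 // ltxx.
Qed.

End NormSequence.

Theorem theorem3p3 (p : nat) (p_prime : prime p) (p_odd : odd p) (c : padic p)
  (c_norm : padic_norm c = 1) :
  backward_julia c `<=` C0 c.
Proof.
move=> z [zQ [M zM]]; split=> //.
(* The default [z] is never reached: all iterates exist by [zQ]. *)
pose w n := odflt z (fmap_inv_iter c n z).
have wE n : fmap_inv_iter c n z = Some (w n).
  rewrite /w; case: n => // n.
  by have := zQ n.+1 isT; case: (fmap_inv_iter c n.+1 z).
have wS n : (w n).2 != 0 /\ fmap c (w n.+1) = w n.
  apply/fmap_invP; rewrite -(wE n.+1) /fmap_inv_iter iterS.
  by rewrite -/(fmap_inv_iter c n z) wE.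
have w2 n : (w n).2 = (w n.+1).1 by have [_ <-] := wS n.
pose r n := padic_norm (w n).1.
(* All three product rules follow from this identity by comparing [r n] with the norm 1 of [c]. *)
have rM n : r n.+1 * r n.+2 = padic_norm ((w n).1 - c).
  by rewrite /r -padic_normM -(w2 n.+1); have [_ <-] := wS n; rewrite /= addrK.
(* The second coordinate of [z] is the first of [w 1], so the goal concerns [r 0] and [r 1]. *)
rewrite /padic_norm2 -[z]/(w 0) w2.
apply: (@norm_seq_max_eq1 r M) => n.
- exact: padic_norm_ge0.
- apply: le_trans (zM n.+1 _ isT (wE n.+1)).
  by rewrite /padic_norm2 le_max lexx.
- exact: padic_norm_gt1_ge2.
- by move=> n0; rewrite rM padic_normBl // c_norm.
- by move=> n0; rewrite rM padic_normBr ?c_norm.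
- move=> n0; rewrite rM; apply: le_trans (padic_normB _ _ _) _.
  by rewrite -/(r n) n0 c_norm maxxx.
Qed.
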